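(* Let $\mathsf{F}$ be a field, let $n$ and $k$ be positive integers, and let $S$ be a finite nonempty subset of $\mathsf{F}$. (1) It is possible to check whether a black-box matrix $A \in \mathsf{F}^{n \times n}$ is a band matrix with band width $k$, by selecting $n$ values uniformly and independently from $S$ and by performing $\Theta(\mu k)$ arithmetic operations over $\mathsf{F}$. If $A$ is a band matrix with band width $k$, then this is confirmed with certainty. Otherwise the probability that $A$ is mistaken for a band matrix with band width $k$ is at most $1/|S|$. (2) A certificate with size $\Theta(nk)$, which also allows algorithms for band matrix computations to be applied to $A$, can be supplied when $A$ is a band matrix with band width $k$. This certificate can be verified by selecting $n$ entries uniformly and independently from $S$ and using $\Theta(nk+\mu)$ arithmetic operations over $\mathsf{F}$. If $A$ is a band matrix with band width $k$ and the certificate is correct, then it is accepted with certainty. If the certificate is incorrect then it is accepted with probability at most $1/|S|$.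
   Context: A matrix $A \in \mathsf{F}^{n\times n}$ with entries $a_{i,j}$ is a band matrix with band width $k$ if $a_{i,j}=0$ whenever $1\le i,j\le n$ and $|i-j|>k$. Black-box model: $A$ is accessed only through multiplication by vectors. $\mu$ denotes the number of operations in $\mathsf{F}$ required to multiply either $A$ or $A^T$ by a given vector in $\mathsf{F}^{n\times 1}$; it is assumed that $n \le \mu \le n(2n+1)$. Costs are counted in arithmetic operations (including zero tests) in $\mathsf{F}$. A certificate is a representation of a matrix as a band matrix with band width $k$, i.e. an $n\times(2k+1)$ array reporting the entries within the bands (positions $(i,j)$ with $|i-j|\le k$). It is correct if the band matrix it represents equals $A$. It is produced by one party (the prover) and checked by another (the verifier), who has black-box access to $A$. *)

(* Defs.v *)
From mathcomp Require Import all_boot all_order all_algebra.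
From mathcomp Require Import finmap.

Set Implicit Arguments.
Unset Strict Implicit.
Unset Printing Implicit Defensive.

Import Order.TTheory GRing.Theory Num.Theory.
Local Open Scope ring_scope.

Definition is_band (F : fieldType) (n k : nat) (A : 'M[F]_n) : Prop :=
  forall i j : 'I_n, (k < `|i - j|)%N -> A i j = 0.

(* Diagonal-wise band storage: cell (i, d) of the array stores the entry
   (i, i + d - k); cells whose column i + d - k falls outside 0 .. n-1 carry
   no information. *)
Definition band_of (F : fieldType) (n k : nat) (c : 'M[F]_(n, k.*2.+1)) :
    'M[F]_n :=
  \matrix_(i, j) if (`|i - j| <= k)%N then c i (inord (j + k - i)) else 0.

Definition correct_certificate (F : fieldType) (n k : nat) (A : 'M[F]_n)
    (c : 'M[F]_(n, k.*2.+1)) : Prop :=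
  band_of c = A.

Definition entries (F : fieldType) (m p : nat) (c : 'M[F]_(m, p)) : seq F :=
  [seq c i d | i <- enum 'I_m, d <- enum 'I_p].

Inductive arith_op := Add | Sub | Mul | Div.

Definition eval_op (F : fieldType) (o : arith_op) (x y : F) : F :=
  match o with
  | Add => x + y
  | Sub => x - y
  | Mul => x * y
  | Div => x / y
  end.

(* A tree works on a store, a finite sequence of field elements addressed by
   position and initially containing the inputs; each step appends its results
   at the end of the store.  The tree is pure syntax: it mentions addresses and
   never field elements, so the field, the inputs and the matrix can influence
   a run only through steps that are charged for.  Constants are free.
   In [Product tr v t] the vector has its l-th entry at address v l, and is
   multiplied by A^T if tr is true, by A otherwise. *)
Inductive tree (n : nat) : Type :=
| Answer of bool
| Const of bool & tree n
| Arith of arith_op & nat & nat & tree n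
| ZeroTest of nat & tree n & tree n
| Product of bool & ('I_n -> nat) & tree n.

Record outcome := Outcome {
  accepted : bool;
  field_ops : nat;  (* arithmetic operations and zero tests *)
  products : nat    (* multiplications of A or A^T by a vector *)
}.

Definition tick_op (r : outcome) : outcome :=
  Outcome (accepted r) (field_ops r).+1 (products r).

Definition tick_product (r : outcome) : outcome :=
  Outcome (accepted r) (field_ops r) (products r).+1.

(* Reading an address beyond the end of the store yields 0, and x / 0 = 0. *)
Fixpoint run (F : fieldType) (n : nat) (A : 'M[F]_n) (t : tree n)
    (store : seq F) : outcome :=
  match t with
  | Answer b => Outcome b 0 0
  | Const b t1 => run A t1 (rcons store b%:R)
  | Arith o i j t1 =>
      tick_op (run A t1 (rcons store (eval_op o store`_i store`_j)))
  | ZeroTest i t1 t2 =>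
      tick_op (if store`_i == 0 then run A t1 store else run A t2 store)
  | Product tr v t1 =>
      let B := if tr then A^T else A in
      let w := B *m \col_l store`_(v l) in
      tick_product (run A t1 (store ++ [seq w l 0 | l <- enum 'I_n]))
  end.

Definition cost (mu : nat) (r : outcome) : nat :=
  (field_ops r + mu * products r)%N.

(* An element of [n.-tuple S] is the outcome of n selections from S; these are
   uniform and independent when the tuple is uniformly distributed. *)
Definition values (F : fieldType) (S : {fset F}) (n : nat) (x : n.-tuple S) :
    seq F :=
  [seq val s | s <- x].

Definition uniform_prob (T : finType) (E : pred T) : rat :=
  #|[set x | E x]|%:R / #|T|%:R.

Definition theta_within (C f g : nat) : bool :=
  ((f <= C * g) && (g <= C * f))%N.

(* Main.v *)
(* Given an array of candidate band entries, let B be the band matrix that it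
   represents.  One product A x and Theta(nk) field operations decide whether
   A x = B x, and if A - B has a nonzero entry then, the other coordinates of x
   being fixed, at most one choice of one coordinate gives (A - B) x = 0.  This
   is the verifier.  The checker first obtains its own array from 2k + 1
   products of A with indicator vectors of the residue classes modulo 2k + 1:
   this is the band of A when A is a band matrix, and otherwise B, a band matrix
   independent of x, differs from A. *)
Require Import Defs.
From mathcomp Require Import all_boot all_order all_algebra.
From mathcomp Require Import finmap.
From mathcomp Require Import zify.

Set Implicit Arguments.
Unset Strict Implicit.
Unset Printing Implicit Defensive.

Import Order.TTheory GRing.Theory Num.Theory.
Local Open Scope ring_scope.

(** * Stores built by appending blocks *)

Section FoldlCat.
Variables (T E : Type) (x0 : T) (g : seq T -> E -> seq T).

(** Each block [g s e] may read the whole store so far; arithmetic steps and products are both of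
    this form. *)
Definition extend (s : seq T) (p : seq E) : seq T :=
  foldl (fun s e => s ++ g s e) s p.

Lemma nth_extend (s : seq T) (p : seq E) (i : nat) :
  (i < size s)%N -> nth x0 (extend s p) i = nth x0 s i.
Proof.
elim: p s => //= e p IHp s lt_i; rewrite IHp ?nth_cat ?lt_i //.
by rewrite size_cat ltn_addr.
Qed.

Lemma extend_cat (s : seq T) (p q : seq E) :
  extend s (p ++ q) = extend (extend s p) q.
Proof. exact: foldl_cat. Qed.

Lemma extend_flatten (f : E -> seq T) (s : seq T) (p : seq E) :
  (forall s e, g s e = f e) -> extend s p = s ++ flatten (map f p).
Proof.
by move=> gf; elim: p s => [|e p IHp] s; rewrite /= ?cats0 // IHp gf catA.
Qed.

Variable b : nat.
Hypothesis size_g : forall s e, size (g s e) = b.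

Lemma size_extend (s : seq T) (p : seq E) :
  size (extend s p) = (size s + size p * b)%N.
Proof.
by elim: p s => /= [|e p IHp] s; rewrite ?IHp ?size_cat ?size_g; lia.
Qed.

(** The first l blocks have length [b] each, and later blocks only append. *)
Lemma nth_extend_block (e0 : E) (s : seq T) (p : seq E) (l i : nat) :
  (l < size p)%N -> (i < b)%N ->
  nth x0 (extend s p) (size s + l * b + i) =
    nth x0 (g (extend s (take l p)) (nth e0 p l)) i.
Proof.
move=> lt_l lt_i; rewrite -[p in LHS](cat_take_drop l) (drop_nth e0 lt_l).
rewrite /extend foldl_cat /= -/(extend _ _) -/(extend s _).
have size_l : size (extend s (take l p)) = (size s + l * b)%N.
  by rewrite size_extend size_takel // ltnW.
rewrite nth_extend; last by rewrite size_cat size_g size_l; lia.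
by rewrite nth_cat size_l ltnNge leq_addr /= addKn.
Qed.

Lemma nth_extend_take (s : seq T) (p : seq E) (l i : nat) :
  (l <= size p)%N -> (i < size s + l * b)%N ->
  nth x0 (extend s (take l p)) i = nth x0 (extend s p) i.
Proof.
move=> le_l lt_i; rewrite -[p in RHS](cat_take_drop l) extend_cat.
by rewrite [RHS]nth_extend // size_extend size_takel.
Qed.

End FoldlCat.

(** * Runs of sequences of operations, products and tests *)

Definition charge (p q : nat) (r : outcome) : outcome :=
  Outcome (accepted r) (p + field_ops r) (q + products r).

Lemma cost_charge (mu p q : nat) (r : outcome) :
  cost mu (charge p q r) = (p + mu * q + cost mu r)%N.
Proof. by rewrite /cost /= mulnDr addnACA. Qed.

Definition instr : Type := (arith_op * nat * nat)%type.

Definition arith_val (F : fieldType) (s : seq F) (e : instr) : seq F :=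
  [:: eval_op e.1.1 s`_e.1.2 s`_e.2].

Definition arith_seq (n : nat) (p : seq instr) (t : tree n) : tree n :=
  foldr (fun e => Arith e.1.1 e.1.2 e.2) t p.

Definition product_val (F : fieldType) (n : nat) (A : 'M[F]_n) (s : seq F)
    (v : 'I_n -> nat) : seq F :=
  [seq (A *m \col_l s`_(v l)) i 0 | i <- enum 'I_n].

Definition product_seq (n : nat) (vs : seq ('I_n -> nat)) (t : tree n) :
    tree n :=
  foldr (Product false) t vs.

Definition test_seq (n : nat) (l : seq nat) : tree n :=
  foldr (fun i t => ZeroTest i t (Answer n false)) (Answer n true) l.

Section Run.
Variables (F : fieldType) (n : nat) (A : 'M[F]_n).

Lemma run_arith_seq (p : seq instr) (t : tree n) (s : seq F) :
  run A (arith_seq p t) s =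
    charge (size p) 0 (run A t (extend (@arith_val F) s p)).
Proof.
elim: p s => [|e p IHp] s; first by rewrite /= /charge; case: (run _ _ _).
by rewrite /= IHp -cats1.
Qed.

Lemma run_product_seq (vs : seq ('I_n -> nat)) (t : tree n) (s : seq F) :
  run A (product_seq vs t) s =
    charge 0 (size vs) (run A t (extend (product_val A) s vs)).
Proof.
elim: vs s => [|v vs IHvs] s; first by rewrite /= /charge; case: (run _ _ _).
by rewrite /= IHvs.
Qed.

Lemma accepted_test_seq (l : seq nat) (s : seq F) :
  accepted (run A (test_seq n l) s) = all (fun i => s`_i == 0) l.
Proof. by elim: l => //= i l IHl; case: ifP => //=; rewrite IHl. Qed.

(** A nonzero entry ends the run early, hence a bound instead of an exact count. *)
Lemma field_ops_test_seq (l : seq nat) (s : seq F) :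
  (field_ops (run A (test_seq n l) s) <= size l)%N.
Proof. by elim: l => //= i l IHl; case: ifP. Qed.

Lemma products_test_seq (l : seq nat) (s : seq F) :
  products (run A (test_seq n l) s) = 0%N.
Proof. by elim: l => //= i l IHl; case: ifP. Qed.

Lemma size_product_val (s : seq F) (v : 'I_n -> nat) :
  size (product_val A s v) = n.
Proof. by rewrite size_map size_enum_ord. Qed.

Lemma nth_product_val (s : seq F) (v : 'I_n -> nat) (i : 'I_n) :
  (product_val A s v)`_i = (A *m \col_l s`_(v l)) i 0.
Proof. by rewrite (nth_map i) ?size_enum_ord // nth_ord_enum. Qed.

Lemma size_extend_arith (s : seq F) (p : seq instr) :
  size (extend (@arith_val F) s p) = (size s + size p)%N.
Proof. by rewrite (@size_extend _ _ _ 1) // muln1. Qed.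

(** Operands lie before the result, so they can be read in the final store [s']; this gives a
    recursion inside [s'] alone. *)
Lemma nth_extend_arith (s : seq F) (N : nat) (f : nat -> instr) (l : nat) :
  (l < N)%N -> ((f l).1.2 < size s + l)%N -> ((f l).2 < size s + l)%N ->
  let s' := extend (@arith_val F) s (mkseq f N) in
  s'`_(size s + l) = eval_op (f l).1.1 s'`_(f l).1.2 s'`_(f l).2.
Proof.
move=> lt_l lt1 lt2 s'.
have := @nth_extend_block _ _ 0 (@arith_val F) 1 (fun _ _ => erefl) (f 0) s
  (mkseq f N) l 0.
rewrite size_mkseq muln1 addn0 => -> //; rewrite nth_mkseq //=.
by rewrite !(@nth_extend_take _ _ _ _ 1) ?size_mkseq ?muln1 // ltnW.
Qed.

End Run.

(** * Comparison of A x with the product by a stored band array *)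

(* The store has size m, holds the entries of a vector from address x0 on and
   0 at address z; cell (i, d) of a band array is at address a i d.  Cells outside
   the matrix are multiplied by 0 instead of being skipped, and all tests come
   last, so that the cost is Theta(nk) even for k >= n or early rejection. *)
Section Check.
Variables (n k : nat) (a : nat -> nat -> nat) (x0 z m : nat).

Local Notation K := (k.*2.+1).
Local Notation N := (n * K)%N.

Definition term_instr (l : nat) : instr :=
  let i := (l %/ K)%N in let d := (l %% K)%N in
  (Mul, a i d,
   if (k <= i + d < n + k)%N then (x0 + (i + d - k))%N else z).

(* For l = i (2k + 1) + d: (A x)_i minus the first d + 1 terms of row i. *)
Definition residue_instr (l : nat) : instr :=
  (Defs.Sub, if (l %% K == 0)%N then (m + l %/ K)%N else (m + n + N + l.-1)%N,
   (m + n + l)%N).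

Definition residue_addr (i : nat) : nat := (m + n + N + (i * K + k.*2))%N.

(** The product A x is placed from [m] on, the terms from [m + n] on and the residues from
    [m + n + N] on. *)
Definition check : tree n :=
  Product false (fun l => (x0 + l)%N)
    (arith_seq (mkseq term_instr N)
      (arith_seq (mkseq residue_instr N)
        (test_seq n (mkseq residue_addr n)))).

Variables (F : fieldType) (A : 'M[F]_n) (s : seq F) (x : 'cV[F]_n).
Variable c : 'M[F]_(n, k.*2.+1).

Lemma products_check : products (run A check s) = 1%N.
Proof. by rewrite /= !run_arith_seq /= products_test_seq. Qed.

Lemma field_ops_check :
  (2 * N <= field_ops (run A check s) <= 2 * N + n)%N.
Proof.
rewrite /= !run_arith_seq /= !size_mkseq.
set t := field_ops _; have : (t <= n)%N.
  by rewrite (leq_trans (field_ops_test_seq _ _ _)) // size_mkseq.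
lia.
Qed.

Hypothesis size_s : size s = m.
Hypothesis a_lt : forall i d, (i < n)%N -> (d < K)%N -> (a i d < m)%N.
Hypothesis x_lt : (x0 + n <= m)%N.
Hypothesis z_lt : (z < m)%N.
Hypothesis s_z : s`_z = 0.
Hypothesis s_x : forall j : 'I_n, s`_(x0 + j) = x j 0.
Hypothesis s_c : forall (i : 'I_n) (d : 'I_K), s`_(a i d) = c i d.

Lemma mulmx_band_of (i : 'I_n) :
  (band_of c *m x) i 0 =
  \sum_(d < K) c i d *
    (if (k <= i + d < n + k)%N then s`_(x0 + (i + d - k)) else 0).
Proof.
rewrite mxE (bigID (fun j : 'I_n => `|i - j| <= k)%N) /=
  [X in _ + X]big1 ?addr0; last by move=> j /negbTE h; rewrite mxE h mul0r.
rewrite [RHS](bigID (fun d : 'I_K => k <= i + d < n + k)%N) /=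
  [X in _ = _ + X]big1 ?addr0; last by move=> d /negbTE ->; rewrite mulr0.
(* [col] and [dia] are inverse bijections between the cells of row i inside the matrix and the
   columns within distance k of i; their default values do not occur there. *)
pose col (d : 'I_K) : 'I_n := insubd i (i + d - k)%N.
pose dia (j : 'I_n) : 'I_K := inord (j + k - i).
have colE (d : 'I_K) : (k <= i + d < n + k)%N -> col d = (i + d - k)%N :> nat.
  by move=> h; rewrite val_insubd ifT //; lia.
rewrite (reindex_onto col dia) /=.
  apply: eq_big => [d|d /andP[h1 h2]].
    have lt_d := ltn_ord d; have lt_i := ltn_ord i.
    apply/andP/idP => [[h /eqP <-]|h].
      have lt_c := ltn_ord (col d).
      by rewrite inordK; lia.
    rewrite colE //; split; first lia.
    apply/eqP/val_inj; rewrite /= inordK colE //; lia.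
  have h : (k <= i + d < n + k)%N.
    have lt_c := ltn_ord (col d); have lt_d := ltn_ord d.
    by rewrite -(eqP h2) inordK; lia.
  by rewrite mxE h1 h -colE // s_x -[inord _]/(dia (col d)) (eqP h2).
move=> j h; apply/val_inj; have lt_j := ltn_ord j.
by rewrite /= colE inordK; lia.
Qed.

Lemma accepted_check :
  accepted (run A check s) = (A *m x == band_of c *m x).
Proof.
rewrite /= !run_arith_seq /= accepted_test_seq.
rewrite -[[seq _ | l <- enum _]]/(product_val A s (fun l => (x0 + l)%N)).
(* The stores after the product, the terms and the residues; each extends the preceding one. *)
set s1 := s ++ _; set s2 := extend _ s1 _; set s3 := extend _ s2 _.
have size1 : size s1 = (m + n)%N by rewrite size_cat size_s size_product_val.
have size2 : size s2 = (m + n + N)%N.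
  by rewrite size_extend_arith size1 size_mkseq.
have s12 l : (l < m + n)%N -> s2`_l = s1`_l.
  by move=> lt_l; rewrite nth_extend ?size1.
have s23 l : (l < m + n + N)%N -> s3`_l = s2`_l.
  by move=> lt_l; rewrite nth_extend ?size2.
have s01 l : (l < m)%N -> s1`_l = s`_l.
  by move=> lt_l; rewrite nth_cat size_s lt_l.
have s1A (i : 'I_n) : s1`_(m + i) = (A *m x) i 0.
  rewrite nth_cat size_s ltnNge leq_addr /= addKn nth_product_val.
  by congr ((A *m _) i 0); apply/colP => j; rewrite mxE s_x.
pose term (i : 'I_n) (d : nat) := c i (inord d) *
    (if (k <= i + d < n + k)%N then s`_(x0 + (i + d - k)) else 0).
have div_cell (i : 'I_n) d : (d < K)%N -> ((i * K + d) %/ K = i)%N.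
  by move=> lt_d; rewrite divnMDl // divn_small ?addn0.
have mod_cell (i : 'I_n) d : (d < K)%N -> ((i * K + d) %% K = d)%N.
  by move=> lt_d; rewrite modnMDl modn_small.
have cell_lt (i : 'I_n) d : (d < K)%N -> (i * K + d < N)%N.
  move=> lt_d; have lt_i := ltn_ord i.
  rewrite (@leq_trans (i.+1 * K)) ?leq_mul2r ?lt_i ?orbT //.
  by rewrite mulSn addnC ltn_add2r.
have s2t (i : 'I_n) d : (d < K)%N -> s2`_(m + n + (i * K + d)) = term i d.
  move=> lt_d; have a_lt_id := a_lt (ltn_ord i) lt_d.
  rewrite -size1 nth_extend_arith ?cell_lt //= ?size1 div_cell // mod_cell //;
    [|lia|by case: ifP; lia].
  rewrite -/s2 s12; last lia.
  have sc : s`_(a i d) = c i (inord d) by rewrite -s_c inordK.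
  rewrite s01 // sc s12; last by case: ifP; lia.
  rewrite s01; last by case: ifP; lia.
  by rewrite /term; case: ifP => // _; rewrite s_z.
have s3t (i : 'I_n) d : (d < K)%N ->
    s3`_(m + n + N + (i * K + d)) = (A *m x) i 0 - \sum_(e < d.+1) term i e.
  (* The first residue starts from (A x)_i, each later one from its predecessor in the same row. *)
  elim: d => [|d IHd] lt_d; rewrite -size2 nth_extend_arith ?cell_lt //= ?size2;
    rewrite ?mod_cell //=; try (move: (cell_lt i _ lt_d); lia).
  - rewrite div_cell // -/s3 s23; last by have := ltn_ord i; lia.
    rewrite s12 ?ltn_add2l // s1A s23; last by move: (cell_lt i _ lt_d); lia.
    by rewrite s2t // big_ord1.
  - rewrite div_cell //; have := ltn_ord i; lia.
  rewrite -/s3 addnS /= IHd; last exact: ltnW.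
  rewrite s23; last by move: (cell_lt i _ lt_d); lia.
  by rewrite -addnS s2t // [in RHS]big_ord_recr /= opprD addrA.
(* The tested cell has d = 2k, where all 2k + 1 terms have been subtracted. *)
have testE (i : 'I_n) : (s3`_(residue_addr i) == 0) =
    ((A *m x) i 0 == (band_of c *m x) i 0).
  rewrite s3t ?ltnS // subr_eq0 mulmx_band_of; congr (_ == _).
  by apply: eq_bigr => d _; rewrite /term inord_val.
apply/allP/eqP => [h|h].
  apply/colP => i; apply/eqP; rewrite -testE; apply: h.
  by apply: map_f; rewrite mem_iota /=.
move=> addr /mapP[i]; rewrite mem_iota /= => lt_i ->.
by have := testE (Ordinal lt_i); rewrite h eqxx.
Qed.

End Check.

Lemma is_band_band_of (F : fieldType) (n k : nat) (c : 'M[F]_(n, k.*2.+1)) :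
  is_band k (band_of c).
Proof. by move=> i j h; rewrite mxE leqNgt h. Qed.

Lemma band_ofP (F : fieldType) (n k : nat) (A : 'M[F]_n)
    (c : 'M[F]_(n, k.*2.+1)) :
  is_band k A ->
  (forall (i j : 'I_n), (`|i - j| <= k)%N -> c i (inord (j + k - i)) = A i j) ->
  band_of c = A.
Proof.
move=> bA cA; apply/matrixP => i j; rewrite mxE.
by case: leqP => [/cA|/bA].
Qed.

(** * Probability of a wrong acceptance *)

Section Freivalds.
Variables (F : fieldType) (n : nat) (S : {fset F}).

Definition value_col (x : n.-tuple S) : 'cV[F]_n := \col_j val (tnth x j).

(* Off one coordinate j0 of a nonzero entry M i0 j0, the entries of x in the
   kernel determine the remaining one, so overwriting it is injective. *)
Lemma card_kernel (M : 'M[F]_n) : M != 0 ->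
  (#|[set x : n.-tuple S | (M *m value_col x == 0)%R]| * #|` S| <=
     #|{: n.-tuple S}|)%N.
Proof.
move=> nzM.
have /existsP[i0 /existsP[j0 nz]] : [exists i, exists j, M i j != 0].
  apply: contraNT nzM; rewrite negb_exists => /forallP h.
  apply/eqP/matrixP => i j; have := h i; rewrite negb_exists => /forallP/(_ j).
  by rewrite negbK mxE => /eqP.
set E := [set x | _].
rewrite cardfE -cardsT -cardsX.
(* The domain consists of pairs in E x S, so injectivity into the set of all tuples gives the
   product bound. *)
pose f (p : n.-tuple S * S) :=
  [tuple if j == j0 then p.2 else tnth p.1 j | j < n].
rewrite -(@card_in_imset _ _ f) ?max_card //.
move=> [x s] [y t]; rewrite !inE !andbT /= => /eqP Ex /eqP Ey fE.
have fj j :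
    (if j == j0 then s else tnth x j) = (if j == j0 then t else tnth y j).
  by have := congr1 (fun u => tnth u j) fE; rewrite !tnth_mktuple.
have <- : s = t by have := fj j0; rewrite eqxx.
congr (_, _); apply: eq_from_tnth => j.
have off l : l != j0 -> tnth x l = tnth y l.
  by move=> /negbTE h; have := fj l; rewrite h.
have [->|] := eqVneq j j0; last exact: off.
(* Row i0 of M (x - y) reduces to M i0 j0 times the difference at j0. *)
have : (M *m value_col x - M *m value_col y) i0 0 = 0.
  by rewrite Ex Ey subrr mxE.
rewrite -mulmxBr mxE (bigD1 j0) //= big1 ?addr0.
  move=> /eqP; rewrite mulf_eq0 (negbTE nz) /= !mxE subr_eq0 => /eqP h.
  exact: val_inj.
by move=> l /off h; rewrite !mxE h subrr mulr0.
Qed.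

(** The event says that x is in the kernel of the nonzero matrix A - B, where A and B are fixed
    before x. *)
Lemma freivalds (A B : 'M[F]_n) (E : pred (n.-tuple S)) :
  S != fset0 -> A <> B ->
  (forall x, E x = (A *m value_col x == B *m value_col x)) ->
  uniform_prob E <= (#|` S|%:R)^-1.
Proof.
move=> S0 /eqP AB EE; have card_gt0S : (0 < #|` S|)%N by rewrite cardfs_gt0.
have card_gt0T : (0 < #|{: n.-tuple S}|)%N.
  by rewrite card_tuple expn_gt0 -cardfE card_gt0S.
rewrite /uniform_prob ler_pdivrMr ?ltr0n // mulrC ler_pdivlMr ?ltr0n //.
rewrite -natrM ler_nat (leq_trans _ (@card_kernel (A - B) _)) ?subr_eq0 //.
rewrite leq_mul2r; apply/orP; right; apply: subset_leq_card.
by apply/subsetP => x; rewrite !inE EE mulmxBl subr_eq0.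
Qed.

Lemma size_values (x : n.-tuple S) : size (values x) = n.
Proof. by rewrite size_map size_tuple. Qed.

Lemma nth_values (x : n.-tuple S) (j : 'I_n) : (values x)`_j = value_col x j 0.
Proof.
by rewrite mxE /values (nth_map (tnth x j)) ?size_tuple // -tnth_nth.
Qed.

End Freivalds.

(** * The two trees and the layout of their stores *)

Lemma size_entries (F : fieldType) (m p : nat) (c : 'M[F]_(m, p)) :
  size (entries c) = (m * p)%N.
Proof. by rewrite size_allpairs !size_enum_ord. Qed.

Lemma nth_entries (F : fieldType) (m p : nat) (c : 'M[F]_(m, p))
    (i : 'I_m) (d : 'I_p) :
  (entries c)`_(i * p + d) = c i d.
Proof.
(* Row-major listing is a case of [extend] with blocks that ignore the store. *)
pose row_seq (_ : seq F) i := [seq c i d | d <- enum 'I_p].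
have -> : entries c = extend row_seq [::] (enum 'I_m).
  by rewrite (extend_flatten (f := row_seq [::])).
have size_row s j : size (row_seq s j) = p by rewrite size_map size_enum_ord.
have := nth_extend_block 0 size_row i [::] (l := i) (i := d) (p := enum 'I_m).
rewrite size_enum_ord !ltn_ord => -> //.
by rewrite nth_ord_enum (nth_map d) ?size_enum_ord // nth_ord_enum.
Qed.

(** The certificate starts at 0, x at [n * K], and the constant 0 comes just after x. *)
Definition verifier (n k : nat) : tree n :=
  let K := k.*2.+1 in
  Const false
    (check n k (fun i d => (i * K + d)%N) (n * K) (n * K + n) (n * K + n).+1).

(* Multiplying by the indicator vector of each residue class modulo 2k+1
   isolates the entries of a band matrix, as each row has at most one band
   position in each class. *)
Definition probe (n k r : nat) (l : 'I_n) : nat :=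
  if (l %% k.*2.+1 == r)%N then n.+1 else n.

(** Addresses [n] and [n.+1] hold 0 and 1, and the product for class r starts at [n.+2 + r * n]. The
    array is thus read in place, without arithmetic. *)
Definition probe_addr (n k i d : nat) : nat :=
  (n.+2 + (i + d - k) %% k.*2.+1 * n + i)%N.

(** For i + d < k the subtraction truncates to 0; such a cell lies outside the matrix and carries no
    information. *)
Definition probed (F : fieldType) (n k : nat) (A : 'M[F]_n) :
    'M[F]_(n, k.*2.+1) :=
  \matrix_(i, d)
    \sum_(j < n | (j %% k.*2.+1 == (i + d - k) %% k.*2.+1)%N) A i j.

Definition checker (n k : nat) : tree n :=
  Const false (Const true
    (product_seq (mkseq (@probe n k) k.*2.+1)
      (check n k (probe_addr n k) 0 n (n.+2 + k.*2.+1 * n)))).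

Lemma size_probe_store (F : fieldType) (n k : nat) (A : 'M[F]_n) (s : seq F) :
  size (extend (product_val A) s (mkseq (@probe n k) k.*2.+1)) =
    (size s + k.*2.+1 * n)%N.
Proof. by rewrite (size_extend (size_product_val A)) size_mkseq. Qed.

Lemma nth_probe_store (F : fieldType) (n k : nat) (A : 'M[F]_n) (s : seq F)
    (i : 'I_n) (d : 'I_(k.*2.+1)) :
  size s = n.+2 -> s`_n = 0 -> s`_n.+1 = 1 ->
  (extend (product_val A) s (mkseq (@probe n k) k.*2.+1))`_(probe_addr n k i d)
    = probed k A i d.
Proof.
move=> size_s s0 s1; rewrite /probe_addr -size_s.
rewrite (nth_extend_block 0 (size_product_val A) (@probe n k 0)) ?size_mkseq //;
  last by rewrite ltn_pmod.
rewrite nth_mkseq ?ltn_pmod // nth_product_val !mxE [RHS]big_mkcond /=.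
apply: eq_bigr => j _; rewrite mxE /probe.
by case: eqP => _; rewrite nth_extend ?size_s ?s0 ?s1 ?mulr0 ?mulr1.
Qed.

(** Columns of one class within distance k of i differ by at most 2k, hence coincide; farther
    columns hold zeros. *)
Lemma band_of_probed (F : fieldType) (n k : nat) (A : 'M[F]_n) :
  is_band k A -> band_of (probed k A) = A.
Proof.
move=> bA; apply: band_ofP => // i j ij.
rewrite mxE inordK; last lia.
have -> : (i + (j + k - i) - k = j)%N by lia.
rewrite (bigD1 j) //= big1 ?addr0 // => l /andP[/eqP lj ne_lj].
have [/bA //|il] := ltnP k `|i - l|%N.
have mod_eq (p q : nat) : p = q %[mod k.*2.+1] -> (p <= q)%N ->
    (q - p <= k.*2)%N -> p = q.
  move=> /esym/eqP + le_pq le_k; rewrite eqn_mod_dvd // => /dvdn_leq h.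
  by apply/eqP; rewrite eqn_leq le_pq leqNgt -subn_gt0; apply/negP => /h; lia.
case/negP: ne_lj; apply/eqP/val_inj => /=; have [le_lj|lt_jl] := leqP l j.
  by apply: mod_eq => //; lia.
by apply/esym; apply: mod_eq => //; lia.
Qed.

(** * Cost and acceptance of both trees *)

Section Verifier.
Variables (F : fieldType) (n k : nat) (S : {fset F}) (A : 'M[F]_n).

Lemma cost_verifier (mu : nat) (s : seq F) :
  (0 < n)%N -> (0 < k)%N -> (n <= mu)%N ->
  theta_within 11 (cost mu (run A (verifier n k) s)) (n * k + mu).
Proof.
move=> n_gt0 k_gt0 le_mu; rewrite /theta_within /cost.
rewrite [run _ _ _]/= products_check.
have := field_ops_check k (fun i d => (i * k.*2.+1 + d)%N) (n * k.*2.+1)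
  (n * k.*2.+1 + n) (n * k.*2.+1 + n).+1 A (rcons s 0).
move: (field_ops _) => f /andP[f_ge f_le]; apply/andP; split; nia.
Qed.

Lemma accepted_verifier (c : 'M[F]_(n, k.*2.+1)) (x : n.-tuple S) :
  accepted (run A (verifier n k) (entries c ++ values x)) =
    (A *m value_col x == band_of c *m value_col x).
Proof.
apply: (@accepted_check _ _ _ _ _ _ _ _ _ (value_col x)).
- by rewrite size_rcons size_cat size_entries size_values.
- by move=> i d; nia.
- by lia.
- by lia.
- by rewrite nth_rcons size_cat size_entries size_values ltnn eqxx.
- move=> j; rewrite nth_rcons size_cat size_entries size_values.
  rewrite ltn_add2l ltn_ord nth_cat size_entries ltnNge leq_addr /= addKn.
  exact: nth_values.
- move=> i d; have lt_id : (i * k.*2.+1 + d < n * k.*2.+1)%N.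
    by have := ltn_ord i; have := ltn_ord d; nia.
  rewrite nth_rcons size_cat size_entries ltn_addr // nth_cat size_entries.
  by rewrite lt_id nth_entries.
Qed.

Lemma run_checker (s : seq F) :
  run A (checker n k) s =
    charge 0 k.*2.+1
      (run A (check n k (probe_addr n k) 0 n (n.+2 + k.*2.+1 * n))
        (extend (product_val A) (rcons (rcons s 0) 1)
          (mkseq (@probe n k) k.*2.+1))).
Proof.
by rewrite -[X in charge 0 X](size_mkseq (@probe n k)) -run_product_seq.
Qed.

(** The 2k + 2 products and at most 4nk + 3n field operations cost at most (2 + 2 + 4 + 3) mu k, as
    n <= mu and 1 <= k; hence 11. *)
Lemma cost_checker (mu : nat) (s : seq F) :
  (0 < k)%N -> (n <= mu)%N ->
  theta_within 11 (cost mu (run A (checker n k) s)) (mu * k).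
Proof.
move=> k_gt0 le_mu; rewrite run_checker cost_charge.
rewrite /theta_within /cost products_check.
have := field_ops_check k (probe_addr n k) 0 n (n.+2 + k.*2.+1 * n) A
  (extend (product_val A) (rcons (rcons s 0) 1) (mkseq (@probe n k) k.*2.+1)).
move: (field_ops _) => f /andP[f_ge f_le]; apply/andP; split; nia.
Qed.

(** The matrix compared with A depends on A and k but not on x, so that [freivalds] applies. *)
Lemma accepted_checker (x : n.-tuple S) :
  accepted (run A (checker n k) (values x)) =
    (A *m value_col x == band_of (probed k A) *m value_col x).
Proof.
rewrite run_checker; set s := rcons _ 1; have size_s : size s = n.+2.
  by rewrite !size_rcons size_values.
have s0 : s`_n = 0 by rewrite !nth_rcons size_rcons size_values leqnn ltnn eqxx.
have s1 : s`_n.+1 = 1 by rewrite nth_rcons size_rcons size_values ltnn eqxx.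
apply: (@accepted_check _ _ _ _ _ _ _ _ _ (value_col x)).
- by rewrite size_probe_store size_s.
- move=> i d lt_i lt_d; rewrite /probe_addr.
  have := ltn_pmod (i + d - k) (ltn0Sn k.*2); nia.
- by lia.
- by lia.
- by rewrite nth_extend ?size_s.
- move=> j; have lt_j := ltn_ord j; rewrite nth_extend ?size_s; last lia.
  by rewrite !nth_rcons size_rcons size_values ltnS (ltnW lt_j) lt_j nth_values.
- by move=> i d; apply: nth_probe_store.
Qed.

End Verifier.

Theorem theorem2p1 :
  (exists (C : nat) (checker : forall n k : nat, tree n),
    forall (F : fieldType) (n k : nat) (S : {fset F}),
      (0 < n)%N -> (0 < k)%N -> S != fset0 ->
      forall A : 'M[F]_n,
      [/\ forall (mu : nat) (x : n.-tuple S),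
            (n <= mu <= n * (2 * n + 1))%N ->
            theta_within C (cost mu (run A (checker n k) (values x))) (mu * k),
          is_band k A ->
            forall x : n.-tuple S, accepted (run A (checker n k) (values x))
        & ~ is_band k A ->
            uniform_prob
              (fun x : n.-tuple S => accepted (run A (checker n k) (values x)))
            <= (#|` S|%:R)^-1])
  /\
  (exists (C : nat) (verifier : forall n k : nat, tree n),
    forall (F : fieldType) (n k : nat) (S : {fset F}),
      (0 < n)%N -> (0 < k)%N -> S != fset0 ->
      forall A : 'M[F]_n,
      (is_band k A ->
         exists c : 'M[F]_(n, k.*2.+1), correct_certificate A c) /\
      forall c : 'M[F]_(n, k.*2.+1),
      [/\ theta_within C (size (entries c)) (n * k),
          forall (mu : nat) (x : n.-tuple S),
            (n <= mu <= n * (2 * n + 1))%N ->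
            theta_within C
              (cost mu (run A (verifier n k) (entries c ++ values x)))
              (n * k + mu),
          is_band k A -> correct_certificate A c ->
            forall x : n.-tuple S,
              accepted (run A (verifier n k) (entries c ++ values x))
        & ~ correct_certificate A c ->
            uniform_prob
              (fun x : n.-tuple S =>
                 accepted (run A (verifier n k) (entries c ++ values x)))
            <= (#|` S|%:R)^-1]).
Proof.
split.
  exists 11%N, checker => F n k S n_gt0 k_gt0 S0 A; split.
  - by move=> mu x /andP[le_mu _]; apply: cost_checker.
  - by move=> bA x; rewrite accepted_checker band_of_probed.
  (* The array obtained from the probes always represents a band matrix, so A differs from it. *)
  move=> nbA; apply: freivalds (accepted_checker k A) => // AE.
  by apply: nbA; rewrite AE; apply: is_band_band_of.
exists 11%N, verifier => F n k S n_gt0 k_gt0 S0 A; split.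
  by move=> bA; exists (probed k A); apply: band_of_probed.
move=> c; split.
- by rewrite size_entries /theta_within; nia.
- by move=> mu x /andP[le_mu _]; apply: cost_verifier.
- by move=> _ <- x; rewrite accepted_verifier.
by move=> ncA; apply: freivalds (accepted_verifier A c) => // /esym.
Qed.
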